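(* Let $1\le r\le n$, $T=\{1,\dots,r\}$, and let $X_1,\dots,X_r$ be generic $n\times n$ matrices over $\mathbb{Z}$. Then $$\rho_r(X_1,\dots,X_r)=\sum_{\Delta}(-1)^{\Delta}\,\mathrm{tr}_{\Delta},$$ where the sum is over all partitions $\Delta$ of $T$ (into nonempty parts).
   Context: Let $R_0=\mathbb{Z}[x_{i,j,s}\mid 1\le s\le r,\ 1\le i,j\le n]$ be the polynomial ring in $rn^2$ variables, and let $X_s\in M_n(R_0)$ be the generic matrix with $(i,j)$ entry $x_{i,j,s}$. For an $n\times n$ matrix $Y$ over a commutative ring, $(-1)^i\rho_i(Y)$ is the coefficient of $t^{n-i}$ in the characteristic polynomial of $Y$. $\rho_r(X_1,\dots,X_r)$ denotes the coefficient of $t_1\cdots t_r$ in $\rho_r(t_1X_1+\cdots+t_rX_r)$, computed over $R_0[t_1,\dots,t_r]$. For $k$ matrices, $\mathrm{tr}(a_1,\dots,a_k)=\sum_{\eta}\mathrm{tr}(a_1a_{\eta(2)}\cdots a_{\eta(k)})$, the sum over all permutations $\eta$ of $\{2,\dots,k\}$; it is symmetric in its arguments. For a nonempty $S=\{s_1,\dots,s_k\}\subseteq T$ put $\mathrm{tr}_S=\mathrm{tr}(X_{s_1},\dots,X_{s_k})$. For a set partition $\Delta$: $T=S_1\cup\cdots\cup S_m$ into nonempty (disjoint) parts, put $\mathrm{tr}_\Delta=\prod_i\mathrm{tr}_{S_i}$ and $(-1)^\Delta=(-1)^{\sum_i(|S_i|-1)}$. *)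

(* Defs.v *)
From HB Require Import structures.
From mathcomp Require Import all_boot all_order all_algebra all_fingroup.
From mathcomp Require Import mpoly.

Set Implicit Arguments.
Unset Strict Implicit.
Unset Printing Implicit Defensive.

Import GRing.Theory.

Local Open Scope ring_scope.

(* Meant for i <= n: n - i is truncated, so for i > n this is a dummy value. *)
Definition rho (R : comNzRingType) (n i : nat) (Y : 'M[R]_n) : R :=
  (-1) ^+ i * (char_poly Y)`_(n - i).

(* rho_r(X_1, ..., X_r): the coefficient of t_1 ... t_r, where t_s is the
   variable 'X_s of {mpoly R[r]}. *)
Definition rho_polar (R : comNzRingType) (n r : nat)
    (X : 'I_r -> 'M[R]_n) : R :=
  (rho r (\sum_(s < r) 'X_s *: map_mx (@mpolyC r R) (X s)))
    @_[multinom 1%N | s < r].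

(* tr(a_1, ..., a_k) for the list a_1 :: l, where l = [:: a_2; ...; a_k] is
   indexed from 0; permutations of {2, ..., k} thus become permutations of
   'I_(size l). The value on the empty list is a dummy. *)
Definition mtr (R : comNzRingType) (n : nat) (a : seq 'M[R]_n) : R :=
  if a is a1 :: l then
    \sum_(eta : 'S_(size l)) \tr (a1 *m \prod_(i < size l) l`_(eta i))
  else 0.

(* S is listed in increasing order; mtr is symmetric in its arguments, so the
   order is immaterial. *)
Definition tr_set (R : comNzRingType) (n r : nat) (X : 'I_r -> 'M[R]_n)
    (S : {set 'I_r}) : R :=
  mtr [seq X s | s <- enum S].

Definition tr_part (R : comNzRingType) (n r : nat) (X : 'I_r -> 'M[R]_n)
    (D : {set {set 'I_r}}) : R :=
  \prod_(S in D) tr_set X S.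

Definition sign_part (R : comNzRingType) (r : nat) (D : {set {set 'I_r}}) : R :=
  (-1) ^+ (\sum_(S in D) (#|S| - 1))%N.

Arguments sign_part R {r} D.

(* Z[x_{i,j,s}], one variable for each triple (i, j, s). *)
Definition generic_ring (n r : nat) : comNzRingType :=
  {mpoly int[#|{: 'I_n * 'I_n * 'I_r}|]}.

Definition generic_mx (n r : nat) (s : 'I_r) : 'M[generic_ring n r]_n :=
  \matrix_(i < n, j < n) 'X_(enum_rank (i, j, s)).

(* Main.v *)
Require Import Defs.
From HB Require Import structures.
From mathcomp Require Import all_boot all_order all_algebra all_fingroup.
From mathcomp Require Import mpoly.

Set Implicit Arguments.
Unset Strict Implicit.
Unset Printing Implicit Defensive.

Import GRing.Theory.

Local Open Scope ring_scope.

(** Write [A = t_1 X_1 + ... + t_r X_r].  Since [det (1 + A)] is the sum of the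
    [rho_i A] and [rho_i A] is homogeneous of degree [i] in the [t_s], the
    polarization of [rho_r] is the coefficient of [t_1 ... t_r] in
    [det (1 + A)] ([rho_polarE]).  For a set [S] of indices let [D S] be the
    coefficient of [t_S], the product of the [t_s] for [s] in [S], in
    [det (1 + A)].  Fix [s0] in [S] and put [V = S \ s0].  By Jacobi's formula
    ([mderiv_det]),
      [d/dt_s0 det (1 + A) = tr (X_s0 * adj (1 + A))],
    and modulo terms of degree greater than [#|V|], which cannot contribute to
    the coefficient of [t_V],
      [adj (1 + A) = det (1 + A) * (1 - A + A^2 - ...)].
    The coefficient of [t_U] in [A^k] is zero unless [#|U| = k], when it is the
    sum of the products of the [X_s], [s] in [U], over all orderings of [U]
    ([mxcoef_total_expr]); multiplied by [X_s0], its trace is the trace symbol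
    of the block [s0 |: U].  This gives the recursion
    ([squarefree_det_rec])
      [D S = sum over U included in V of
             (-1)^#|U| tr_(s0 |: U) D (S \ (s0 |: U))].
    The signed sum over the set partitions of [S] satisfies the same recursion:
    single out the block containing [s0] ([sum_partition_block]).  Induction
    on [#|S|] identifies the two sides, over any commutative ring.

    The monomial [t_S] is [mesym1 S]. *)

(** * Coefficients of squarefree monomials *)

(** A factorization of the squarefree monomial of [S] into two monomials is the
    same thing as a splitting of [S] into two disjoint subsets. *)
Lemma mcoeffM_mesym1 (R : nzRingType) (r : nat) (p q : {mpoly R[r]})
    (S : {set 'I_r}) :
  (p * q)@_(mesym1 S) =
  \sum_(U : {set 'I_r} | U \subset S) p@_(mesym1 U) * q@_(mesym1 (S :\: U)).
Proof.
have splitS (U : {set 'I_r}) : U \subset S ->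
    (mesym1 U + mesym1 (S :\: U))%MM = mesym1 S.
  move=> US; apply/mnmP=> i; rewrite mnmDE !mnmE inE.
  by have := subsetP US i; case: (i \in U) => [->|_].
have bnd (U : {set 'I_r}) : U \subset S ->
    (mdeg (mesym1 U) < (mdeg (mesym1 S)).+1)%N.
  by move=> US; rewrite ltnS !mdeg_mesym1 subset_leq_card.
have nz m1 m2 : mesym1 S = (m1 + m2)%MM ->
    [/\ [set i | m1 i != 0%N] \subset S, mesym1 [set i | m1 i != 0%N] = m1 &
        mesym1 (S :\: [set i | m1 i != 0%N]) = m2].
  move/mnmP=> E; have {}E i : ((i \in S) = m1 i + m2 i :> nat)%N.
    by rewrite -mnmDE -E mnmE.
  split.
  - apply/subsetP=> i; rewrite inE; have := E i; case: (i \in S) => //.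
    by case: (m1 i).
  - apply/mnmP=> i; rewrite mnmE inE; have := E i; case: (i \in S).
      by case: (m1 i) => [|[|?]].
    by case: (m1 i).
  - apply/mnmP=> i; rewrite mnmE !inE; have := E i; case: (i \in S).
      by case: (m1 i) => [|[|?]]; case: (m2 i) => [|[|?]].
    by case: (m1 i); case: (m2 i).
rewrite mcoeffM.
(* The product formula ranges over monomials of bounded degree, whence this
   repackaging of [mesym1 U]; the default [bm0] is never reached for subsets of
   [S]. *)
pose b (U : {set 'I_r}) : bmultinom r (mdeg (mesym1 S)).+1 :=
  insubd bm0 (mesym1 U).
have bK (U : {set _}) : U \subset S -> b U = mesym1 U :> 'X_{1.. r}.
  by move=> US; rewrite /b insubdK //; exact: bnd.
rewrite (reindex_onto (fun U : {set 'I_r} => (b U, b (S :\: U)))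
  (fun k => [set i | (k.1 : 'X_{1.. r}) i != 0%N])) /=; last first.
  move=> [k1 k2] /= /eqP E; have [US E1 E2] := nz _ _ E.
  congr (_, _); apply/val_inj=> /=; rewrite bK ?subsetDl //.
have subS (U : {set _}) : mesym1 S = (b U + b (S :\: U))%MM ->
    [set i | (b U : 'X_{1.. r}) i != 0%N] = U -> U \subset S.
  by move=> E EU; have [] := nz _ _ E; rewrite EU.
apply: eq_big => [U|U /andP[/eqP E /eqP EU]].
  apply/andP/idP=> [[/eqP E /eqP EU]|US]; first exact: subS.
  rewrite !bK ?subsetDl // splitS // eqxx; split=> //.
  by apply/eqP/setP=> i; rewrite inE mnmE eqb0 negbK.
by rewrite !bK ?subsetDl ?subS.
Qed.

(** * Derivative of a determinant *)

Lemma mderiv_prod (R : comNzRingType) (r : nat) (i : 'I_r) (I : finType)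
    (F : I -> {mpoly R[r]}) :
  (\prod_j F j)^`M(i) =
  \sum_k \prod_j (if j == k then (F j)^`M(i) else F j).
Proof.
have seqd (s : seq I) : uniq s -> (\prod_(j <- s) F j)^`M(i) =
    \sum_(k <- s) \prod_(j <- s) (if j == k then (F j)^`M(i) else F j).
  elim: s => [|j s IH] /=; first by rewrite !big_nil -mpolyC1 mderivC.
  case/andP=> js us; rewrite !big_cons mderivM IH // eqxx; congr (_ * _ + _).
    apply: eq_big_seq => k ks; case: eqP => // E; by rewrite -E ks in js.
  rewrite big_distrr /=; apply: eq_big_seq => k ks; rewrite big_cons.
  by case: eqP => // E; rewrite E ks in js.
by rewrite seqd ?index_enum_uniq.
Qed.

(** Jacobi's formula.  Differentiating one row at a time gives a sum of
    determinants; expanding each along its differentiated row gives the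
    adjugate. *)
Lemma mderiv_det (R : comNzRingType) (r n : nat) (i : 'I_r)
    (M : 'M[{mpoly R[r]}]_n) :
  (\det M)^`M(i) = \tr (map_mx (mderiv i) M *m \adj M).
Proof.
rewrite [RHS](_ : _ = \sum_k \det (\matrix_(a, b)
    (if a == k then (M a b)^`M(i) else M a b))); last first.
  apply: eq_bigr => k _; rewrite mxE (expand_det_row _ k); apply: eq_bigr => b _.
  rewrite !mxE eqxx; congr (_ * (_ * _)); congr (\det _).
  by apply/matrixP=> a c; rewrite !mxE eq_sym (negbTE (neq_lift _ _)).
rewrite /determinant raddf_sum exchange_big /=; apply: eq_bigr => s _.
rewrite -mulr_sumr !mulr_sign.
have E : (\prod_j M j (s j))^`M(i) = \sum_k \prod_j
    (\matrix_(a, b) (if a == k then (M a b)^`M(i) else M a b)) j (s j).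
  rewrite mderiv_prod; apply: eq_bigr => k _.
  by apply: eq_bigr => a _; rewrite mxE.
by case: (odd_perm s); rewrite ?mderivN ?E //.
Qed.

(** * The polarization as a coefficient of det (1 + A) *)

Definition total_mx (R : comNzRingType) (n r : nat) (X : 'I_r -> 'M[R]_n) :
  'M[{mpoly R[r]}]_n := \sum_(s < r) 'X_s *: map_mx (@mpolyC r R) (X s).

Lemma total_mxE (R : comNzRingType) (n r : nat) (X : 'I_r -> 'M[R]_n) i j :
  total_mx X i j = \sum_(s < r) X s i j *: 'X_s.
Proof.
rewrite summxE; apply: eq_bigr => s _.
by rewrite !mxE mulrC mul_mpolyC.
Qed.

(** The characteristic polynomial of [A] is homogeneous of degree [n] when the
    main variable has degree 1 like the [t_s], because every entry of its
    defining matrix is homogeneous of degree 1. *)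
Lemma mcoeff_char_poly (R : comNzRingType) (n r : nat) (X : 'I_r -> 'M[R]_n)
    (k : nat) (m : 'X_{1.. r}) :
  (mdeg m + k)%N != n -> (char_poly (total_mx X))`_k@_m = 0.
Proof.
(* [hom d p]: [p] is homogeneous of total degree [d] in the main variable and
   the [t_s] together. *)
pose hom d (p : {poly {mpoly R[r]}}) :=
  forall k m, (mdeg m + k)%N != d -> p`_k@_m = 0.
have hom1 : hom 0%N 1.
  move=> {}k {}m; rewrite coef1 mcoeffMn mcoeff1 -mulrnA -mdeg_eq0 addn_eq0.
  by case: eqP => //; case: eqP.
have homM d e p q : hom d p -> hom e q -> hom (d + e)%N (p * q).
  move=> hp hq {}k {}m mk; rewrite coefM raddf_sum big1 // => i _ /=.
  rewrite mcoeffM big1 // => -[m1 m2] /= /eqP/(congr1 mdeg); rewrite mdegD => E.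
  have [E1|N1] := eqVneq (mdeg m1 + i)%N d; last by rewrite hp ?mul0r.
  have [E2|N2] := eqVneq (mdeg m2 + (k - i))%N e; last by rewrite hq ?mulr0.
  have Ek : (mdeg m + k = mdeg m1 + mdeg m2 + k)%N := congr1 (addn^~ k) E.
  case/eqP: mk; rewrite Ek -E1 -E2 addnACA subnKC //.
  by rewrite -ltnS ltn_ord.
suff: hom n (char_poly (total_mx X)) by apply.
move=> {}k {}m mk.
rewrite coef_sum raddf_sum big1 // => s _ /=.
rewrite mulr_sign.
suff H : (\prod_(i < n) char_poly_mx (total_mx X) i (s i))`_k@_m = 0.
  by case: (odd_perm s); rewrite ?coefN ?mcoeffN H ?oppr0.
suff H : hom (\sum_(i < n) 1)%N (\prod_(i < n) char_poly_mx (total_mx X) i (s i)).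
  by apply: H; rewrite sum1_card card_ord.
apply: (big_ind2 (fun p d => hom d p)) => //; first by move=> *; apply: homM.
move=> i _ {mk}{}k {}m mk.
rewrite !mxE coefB coefMn coefX coefC mcoeffB mcoeffMn mcoeffMn.
case: k mk => [|[|k]] /= mk.
- rewrite mul0rn sub0r total_mxE raddf_sum big1 ?oppr0 // => t _ /=.
  rewrite mcoeffZ mcoeffX; case: eqP => [E|_]; last by rewrite mulr0.
  by move: mk; rewrite -E mdeg1 addn0.
- rewrite mcoeff1 -mdeg_eq0 mcoeff0 subr0 -mulrnA.
  by move: mk; rewrite addn1 eqSS => /negbTE ->; rewrite mul0rn.
by rewrite !mulr0n mul0rn mcoeff0 subr0.
Qed.

Definition squarefree_det (R : comNzRingType) (n r : nat) (X : 'I_r -> 'M[R]_n)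
  (S : {set 'I_r}) : R := (\det (1%:M + total_mx X))@_(mesym1 S).

(** Up to sign, [det (1 + A)] is the characteristic polynomial of [A] at [-1].
    By homogeneity, only its coefficient of index [n - r] involves monomials of
    degree [r]; this index is a true difference since [r <= n]. *)
Lemma rho_polarE (R : comNzRingType) (n r : nat) (X : 'I_r -> 'M[R]_n) :
  (r <= n)%N -> rho_polar X = squarefree_det X [set: 'I_r].
Proof.
move=> rn; set A := total_mx X.
have detE : \det (1%:M + A) = (-1) ^+ n * (char_poly A).[-1].
  rewrite /char_poly -[in RHS]horner_evalE -det_map_mx -detZ; congr (\det _).
  apply/matrixP=> i j; rewrite !mxE /= /horner_eval hornerD hornerN.
  by rewrite hornerC hornerMn hornerX mulN1r opprB mulNrn opprK addrC.
have -> : rho_polar X = (rho r A)@_(mesym1 setT).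
  rewrite /rho_polar; congr (_@_ _); by apply/mnmP=> i; rewrite !mnmE inE.
rewrite /squarefree_det detE /rho horner_coef size_char_poly.
have rn' : (n - r < n.+1)%N by rewrite ltnS leq_subr.
rewrite mulr_sumr raddf_sum (bigD1 (Ordinal rn')) //= big1 => [|k nk]; last first.
  rewrite mulrCA -exprD -signr_odd mulrC mulr_sign.
  have H : (char_poly A)`_k@_(mesym1 setT) = 0.
    apply: mcoeff_char_poly; rewrite mdeg_mesym1 cardsT card_ord.
    apply: contraNneq nk => E; apply/eqP/val_inj => /=.
    by have := congr1 (subn^~ r) E; rewrite addKn.
  by case: (odd _); rewrite ?mcoeffN H ?oppr0.
rewrite addr0 mulrCA -exprD -signr_odd -[in RHS]signr_odd oddD oddB //.
by rewrite addKb mulrC.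
Qed.

(** * Squarefree coefficients of the powers of A *)

Definition mxcoef (R : nzRingType) (r p q : nat) (S : {set 'I_r})
  (M : 'M[{mpoly R[r]}]_(p, q)) : 'M[R]_(p, q) := map_mx (mcoeff (mesym1 S)) M.

Lemma mxcoefM (R : comNzRingType) (r p q t : nat) (S : {set 'I_r})
    (M : 'M[{mpoly R[r]}]_(p, q)) (N : 'M_(q, t)) :
  mxcoef S (M *m N) =
  \sum_(U : {set 'I_r} | U \subset S) mxcoef U M *m mxcoef (S :\: U) N.
Proof.
apply/matrixP=> i j; rewrite summxE !mxE raddf_sum /=.
under eq_bigr do rewrite mcoeffM_mesym1.
rewrite exchange_big; apply: eq_bigr => U _; rewrite mxE.
by apply: eq_bigr => k _; rewrite !mxE.
Qed.

Lemma scalemx_prod (R : comNzRingType) (n : nat) (I : Type) (s : seq I)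
    (c : I -> R) (F : I -> 'M[R]_n) :
  \prod_(i <- s) (c i *: F i) = (\prod_(i <- s) c i) *: \prod_(i <- s) F i.
Proof.
elim: s => [|i s IH]; first by rewrite !big_nil scale1r.
by rewrite !big_cons IH -!mulmxE -scalemxAl -scalemxAr scalerA.
Qed.

Lemma total_mxX (R : comNzRingType) (n r k : nat) (X : 'I_r -> 'M[R]_n) :
  total_mx X ^+ k =
  \sum_(f : {ffun 'I_k -> 'I_r})
    'X_[\sum_(i < k) U_(f i)] *: map_mx (@mpolyC r R) (\prod_(i < k) X (f i)).
Proof.
have -> : total_mx X ^+ k = \prod_(i < k) total_mx X.
  by rewrite prodr_const card_ord.
rewrite bigA_distr_bigA; apply: eq_bigr => f _.
rewrite scalemx_prod mprodXE; congr (_ *: _).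
by elim/big_rec2: _ => [|i A B _ ->]; rewrite ?map_mx1 // -!mulmxE map_mxM.
Qed.

Lemma mxcoef_total_expr_sum (R : comNzRingType) (n r k : nat)
    (X : 'I_r -> 'M[R]_n) (U : {set 'I_r}) :
  mxcoef U (total_mx X ^+ k) =
  \sum_(f : {ffun 'I_k -> 'I_r} | (\sum_(i < k) U_(f i))%MM == mesym1 U)
    \prod_(i < k) X (f i).
Proof.
rewrite total_mxX; apply/matrixP=> i j; rewrite mxE !summxE raddf_sum /=.
rewrite [RHS]big_mkcond /=; apply: eq_bigr => f _; rewrite !mxE mulrC mul_mpolyC.
by rewrite mcoeffZ mcoeffX; case: eqP; rewrite ?mulr1 ?mulr0.
Qed.

Lemma mxcoef_total_expr_eq0 (R : comNzRingType) (n r k : nat)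
   (X : 'I_r -> 'M[R]_n) (U : {set 'I_r}) :
  #|U| != k -> mxcoef U (total_mx X ^+ k) = 0.
Proof.
move=> Uk; rewrite mxcoef_total_expr_sum big_pred0 // => f.
apply: contraNF Uk => /eqP/(congr1 mdeg); rewrite mdeg_mesym1 mdeg_sum => <-.
by under eq_bigr do rewrite mdeg1; rewrite sum1_card card_ord.
Qed.

(** The exponent of [t_x] on the left is the number of times [f] takes the
    value [x], so the condition compares multiplicities. *)
Lemma sum_mnm1_perm (r k : nat) (f : {ffun 'I_k -> 'I_r}) (t : k.-tuple 'I_r) :
  uniq t ->
  ((\sum_(i < k) U_(f i))%MM == mesym1 [set x in t]) = perm_eq (codom f) t.
Proof.
move=> ut; have cf x : (\sum_(i < k) U_(f i))%MM x = count_mem x (codom f).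
  rewrite mnm_sumE count_map -sum1_count big_enum_cond [RHS]big_mkcond /=.
  by apply: eq_bigr => i _; rewrite mnm1E; case: eqP.
apply/eqP/idP => [/mnmP E|/seq.permP E].
  by apply/allP=> x _ /=; rewrite -cf E mnmE inE count_uniq_mem.
by apply/mnmP=> x; rewrite cf mnmE inE -count_uniq_mem // E.
Qed.

(** In the expansion of [A ^+ k] over words of length [k], the words with
    monomial [t_U] are exactly the orderings of [U], which the permutations of
    an enumeration [t] of [U] parametrize without repetition. *)
Lemma mxcoef_total_expr (R : comNzRingType) (n r k : nat)
   (X : 'I_r -> 'M[R]_n) (t : k.-tuple 'I_r) :
  uniq t ->
  mxcoef [set x in t] (total_mx X ^+ k) =
  \sum_(eta : 'S_k) \prod_(i < k) [seq X s | s <- t]`_(eta i).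
Proof.
move=> ut; rewrite mxcoef_total_expr_sum.
pose g (eta : 'S_k) := [ffun i : 'I_k => tnth t (eta i)].
have g_inj : injective g.
  move=> e1 e2 /ffunP E; apply/permP=> i.
  by apply: (tuple_uniqP _ ut); have := E i; rewrite !ffunE.
have imE (f : {ffun 'I_k -> 'I_r}) :
    ((\sum_(i < k) U_(f i))%MM == mesym1 [set x in t]) =
    (f \in g @: [set: 'S_k]).
  rewrite sum_mnm1_perm //; apply/tuple_permP/imsetP=> [[p]|[p _ ->]].
    move/eq_in_map=> E; exists p; rewrite ?inE //; apply/ffunP=> i.
    by rewrite ffunE E ?mem_enum.
  by exists p; apply: eq_codom => i; rewrite ffunE.
rewrite (eq_bigl _ _ imE) big_imset /=; last by move=> *; exact: g_inj.
apply: eq_big => [eta|eta _]; first by rewrite inE.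
by apply: eq_bigr => i _; rewrite ffunE -(tnth_map X t) (tnth_nth 0).
Qed.

(** The trace symbol fixes its first entry and permutes the others: here the
    first is [s0], and the sum over the orderings of [U] is read off from
    [A ^+ #|U|]. *)
Lemma tr_set_setU1 (R : comNzRingType) (n r : nat) (X : 'I_r -> 'M[R]_n)
    (s0 : 'I_r) (U : {set 'I_r}) :
  enum (s0 |: U) = s0 :: enum U ->
  tr_set X (s0 |: U) = \tr (X s0 *m mxcoef U (total_mx X ^+ #|U|)).
Proof.
rewrite /tr_set => -> /=; set k := size _.
have sk : size (enum U) == k by rewrite /k size_map.
have Uk : #|U| = k by rewrite cardE (eqP sk).
have EU : U = [set x in Tuple sk] by apply/setP=> x; rewrite inE /= mem_enum.
rewrite Uk [in mxcoef U]EU mxcoef_total_expr ?enum_uniq // mulmx_sumr raddf_sum.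
by apply: eq_bigr.
Qed.

(** The trace symbol lists a set in increasing order.  Taking the pivot [s0] to
    be the least element of [S] makes it come first in every subset of [S]
    that contains it. *)
Lemma enum_setU1_head (r : nat) (S : {set 'I_r}) s0 l (U : {set 'I_r}) :
  enum S = s0 :: l -> U \subset S :\ s0 -> enum (s0 |: U) = s0 :: enum U.
Proof.
move=> ES US.
have enumE (V : {set 'I_r}) : enum V = filter (mem V) (Finite.enum 'I_r) by [].
have sub (V : {set 'I_r}) : V \subset S -> enum V = [seq x <- enum S | x \in V].
  move/subsetP=> VS; rewrite !enumE -filter_predI; apply: eq_filter => x /=.
  by case: (boolP (x \in V)) => //= /VS ->.
have s0S : s0 \in S by rewrite -mem_enum ES mem_head.
move: US; rewrite subsetD1 => /andP[US s0U].
rewrite (sub (s0 |: U)) ?subUset ?sub1set ?s0S ?US // (sub U) // ES /=.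
rewrite setU11 (negbTE s0U); congr (_ :: _).
have /andP[s0l _] : uniq (s0 :: l) by rewrite -ES enum_uniq.
by apply: eq_in_filter => x xl; rewrite !inE; case: eqP => // E;
  rewrite -E xl in s0l.
Qed.

(** * The recursion for the coefficients of det (1 + A) *)

Lemma mxcoef_exprN (R : comNzRingType) (n r j : nat) (U : {set 'I_r})
    (A : 'M[{mpoly R[r]}]_n) :
  mxcoef U ((- A) ^+ j) = (-1) ^+ j *: mxcoef U (A ^+ j).
Proof.
have -> : (- A) ^+ j = if odd j then - A ^+ j else A ^+ j.
  elim: j => // j IH; rewrite !exprS IH /=.
  by case: (odd j); rewrite ?mulrNN ?mulNr.
rewrite -signr_odd scaler_sign.
by case: (odd j) => //; apply/matrixP=> a b; rewrite !mxE mcoeffN.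
Qed.

(** From [(1 + A) * B = 1 - (- A) ^+ k.+1], where [B] is the truncated geometric
    series, the adjugate is [\det (1 + A) *: B] up to a multiple of
    [(- A) ^+ k.+1].  For [k = #|V|] the latter has no [t_V] term: it only
    involves monomials of degree greater than [k]. *)
Lemma mxcoef_adj (R : comNzRingType) (n r : nat) (X : 'I_r -> 'M[R]_n)
    (V : {set 'I_r}) :
  mxcoef V (\adj (1%:M + total_mx X)) =
  \sum_(U : {set 'I_r} | U \subset V)
     ((-1) ^+ #|U| * squarefree_det X (V :\: U)) *:
     mxcoef U (total_mx X ^+ #|U|).
Proof.
set A := total_mx X; set k := #|V|.
pose B := \sum_(i < k.+1) (- A) ^+ i.
have adjE : \adj (1%:M + A) =
    B *m (\det (1%:M + A))%:M + \adj (1%:M + A) *m (- A) ^+ k.+1.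
  rewrite mul_mx_scalar -mul_scalar_mx -mul_adj_mx -mulmxA -mulmxDr.
  rewrite -[LHS]mulmx1; congr (_ *m _).
  have /eqP := subrX1 (- A) k.+1; rewrite subr_eq => /eqP ->.
  rewrite -/B mulmxE addrA -mulrDl.
  by rewrite -opprD [A + 1]addrC subrr mul0r add0r.
have -> : mxcoef V (\adj (1%:M + A)) =
    mxcoef V (B *m (\det (1%:M + A))%:M) +
    mxcoef V (\adj (1%:M + A) *m (- A) ^+ k.+1).
  by rewrite {1}adjE /mxcoef map_mxD.
rewrite !mxcoefM [X in _ + X]big1 ?addr0 => [|U _]; last first.
  rewrite mxcoef_exprN mxcoef_total_expr_eq0 ?scaler0 ?mulmx0 // neq_ltn ltnS.
  by rewrite subset_leq_card ?subsetDl.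
apply: eq_bigr => U UV.
have -> : mxcoef (V :\: U) (\det (1%:M + A))%:M =
    (squarefree_det X (V :\: U))%:M :> 'M_n.
  by apply/matrixP=> a b; rewrite !mxE mcoeffMn.
have -> : mxcoef U B = (-1) ^+ #|U| *: mxcoef U (A ^+ #|U|).
  have Uk : (#|U| < k.+1)%N by rewrite ltnS subset_leq_card.
  have -> : mxcoef U B = \sum_(i < k.+1) mxcoef U ((- A) ^+ i).
    apply/matrixP=> a b; rewrite mxE !summxE raddf_sum.
    by apply: eq_bigr => i _; rewrite mxE.
  rewrite (bigD1 (Ordinal Uk)) //= big1 ?addr0 ?mxcoef_exprN // => i ik.
  rewrite mxcoef_exprN mxcoef_total_expr_eq0 ?scaler0 //.
  by apply: contraNneq ik => E; apply/eqP/val_inj.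
by rewrite mul_mx_scalar scalerA mulrC.
Qed.

(** Since [t_s0] has exponent 1 in [t_S], the coefficient of [t_S] in a
    polynomial is that of [t_S / t_s0] in its derivative along [t_s0]. *)
Lemma squarefree_det_rec (R : comNzRingType) (n r : nat) (X : 'I_r -> 'M[R]_n)
    (S : {set 'I_r}) s0 l :
  enum S = s0 :: l ->
  squarefree_det X S =
  \sum_(U : {set 'I_r} | U \subset S :\ s0)
     (-1) ^+ #|U| * tr_set X (s0 |: U) * squarefree_det X (S :\: (s0 |: U)).
Proof.
move=> ES; have s0S : s0 \in S by rewrite -mem_enum ES mem_head.
set V := S :\ s0.
have mS : mesym1 S = (mesym1 V + U_(s0))%MM.
  apply/mnmP=> i; rewrite mnmDE !mnmE !inE eq_sym.
  by case: eqP => [<-|]; rewrite ?s0S ?addn0.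
have -> : squarefree_det X S = (\det (1%:M + total_mx X))^`M(s0)@_(mesym1 V).
  by rewrite mcoeff_deriv -mS mnmE !inE eqxx.
rewrite mderiv_det.
have -> : map_mx (mderiv s0) (1%:M + total_mx X) = map_mx (@mpolyC r R) (X s0).
  apply/matrixP=> a b; rewrite !mxE mderivD total_mxE raddf_sum /=.
  rewrite (bigD1 s0) //= big1 => [|s ns]; last first.
    by rewrite mderivZ mderivX mnm1E (negbTE ns) scale0r scaler0.
  rewrite mderivZ mderivX mnm1E eqxx scale1r -mpolyC_nat mderivC add0r addr0.
  by rewrite -{1}[U_(s0)%MM]add0m addmK mpolyX0 -mul_mpolyC mulr1.
have -> : (\tr (map_mx (@mpolyC r R) (X s0) *m \adj (1%:M + total_mx X)))@_(mesym1 V)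
    = \tr (X s0 *m mxcoef V (\adj (1%:M + total_mx X))).
  rewrite raddf_sum; apply: eq_bigr => i _; rewrite !mxE raddf_sum.
  by apply: eq_bigr => j _; rewrite !mxE /= mcoeffCM.
rewrite mxcoef_adj mulmx_sumr raddf_sum; apply: eq_bigr => U UV /=.
rewrite -scalemxAr mxtraceZ (tr_set_setU1 _ (enum_setU1_head ES UV)).
by rewrite -setDDl mulrAC.
Qed.

(** * Set partitions *)

(** A partition of [S] is determined by its block [s0 |: U] containing [s0] and
    by the partition of the complement of this block that the other blocks
    form. *)
Lemma sum_partition_block (R : comNzRingType) (T : finType) (S : {set T}) s0
    (w : {set T} -> R) :
    s0 \in S ->
  \sum_(P : {set {set T}} | partition P S) \prod_(B in P) w B =
  \sum_(U : {set T} | U \subset S :\ s0)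
     w (s0 |: U) *
     \sum_(P : {set {set T}} | partition P (S :\: (s0 |: U))) \prod_(B in P) w B.
Proof.
move=> s0S; under [RHS]eq_bigr do rewrite big_distrr.
rewrite pair_big_dep.
have sub_US (U : {set T}) :
    U \subset S :\ s0 -> s0 \notin U /\ s0 |: U \subset S.
  rewrite subsetD1 => /andP[US s0U]; split=> //.
  by rewrite subUset sub1set s0S.
have fresh (U : {set T}) P : partition P (S :\: (s0 |: U)) -> s0 |: U \notin P.
  move=> partP; apply/negP=> /(partitionS partP) /subsetP /(_ s0).
  by rewrite !inE eqxx => /(_ isT).
(* Adding the block [s0 |: U] to a partition of its complement, and removing the
   block of [s0] from a partition of [S], are inverse to each other. *)
have recomp (U : {set T}) P :
    U \subset S :\ s0 -> partition P (S :\: (s0 |: U)) ->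
    partition ((s0 |: U) |: P) S.
  move=> /sub_US[s0U US] partP.
  have -> : S = (s0 |: U) :|: (S :\: (s0 |: U))
    by rewrite -{1}(setIidPr US) setID.
  apply: partitionU1 => //; last by rewrite -setI_eq0 setDE setICA setICr setI0.
  by apply/set0Pn; exists s0; rewrite setU11.
rewrite (reindex_onto (fun UP : {set T} * {set {set T}} => (s0 |: UP.1) |: UP.2)
  (fun P => (pblock P s0 :\ s0, P :\ pblock P s0))) /=; last first.
  move=> P partP; have s0c : s0 \in cover P by rewrite (cover_partition partP).
  by rewrite setD1K ?mem_pblock // setD1K // pblock_mem.
apply: eq_big => [[U P]|[U P]] /=; last first.
  case/andP=> partUP /eqP[defU defP].
  have UnP : s0 |: U \notin P.
    have s0c : s0 \in cover (s0 |: U |: P) by rewrite (cover_partition partUP).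
    have E : pblock (s0 |: U |: P) s0 = s0 |: U.
      by rewrite -{2}defU setD1K // mem_pblock.
    by rewrite -defP E setD11.
  by rewrite big_setU1.
apply/andP/andP=> [[partUP /eqP[defU defP]]|[US partP]].
  have s0c : s0 \in cover (s0 |: U |: P) by rewrite (cover_partition partUP).
  have E : pblock (s0 |: U |: P) s0 = s0 |: U.
    by rewrite -{2}defU setD1K // mem_pblock.
  have inUP : s0 |: U \in s0 |: U |: P by rewrite setU11.
  split; last by rewrite -{1}defP E partitionD1.
  by rewrite -defU E setSD // (partitionS partUP).
have partUP := recomp _ _ US partP.
split=> //; have [s0U _] := sub_US _ US.
rewrite (@def_pblock _ _ (s0 |: U)) ?setU11 ?(partition_trivIset partUP) //.
by rewrite !setU1K ?eqxx ?fresh.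
Qed.

Lemma squarefree_det_partition (R : comNzRingType) (n r : nat)
    (X : 'I_r -> 'M[R]_n) (S : {set 'I_r}) :
  squarefree_det X S =
  \sum_(P : {set {set 'I_r}} | partition P S)
     \prod_(B in P) ((-1) ^+ (#|B| - 1) * tr_set X B).
Proof.
have [k] := ubnP #|S|; elim: k => // k IH in S *; rewrite ltnS => Sk.
case ES: (enum S) => [|s0 l].
  have -> : S = set0 by apply/setP=> i; rewrite -mem_enum ES inE.
  under eq_bigl do rewrite partition_set0.
  rewrite big_pred1_eq big_set0 /squarefree_det mesym1_set0 -det_map_mx.
  rewrite -[RHS](det1 R n); congr (\det _); apply/matrixP=> a b.
  rewrite !mxE /= raddfD /= mcoeffMn mcoeff1 eqxx total_mxE raddf_sum big1 ?addr0 //.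
  by move=> s _; rewrite /= mcoeffZ mcoeffX mnm1_eq0 mulr0.
have s0S : s0 \in S by rewrite -mem_enum ES mem_head.
rewrite (squarefree_det_rec _ ES) (sum_partition_block _ s0S).
apply: eq_bigr => U US; rewrite -IH; last first.
  apply: leq_trans Sk; rewrite -setDDl.
  apply: leq_ltn_trans (subset_leq_card (subsetDl _ _)) _.
  by rewrite [in X in (_ < X)%N](cardsD1 s0) s0S.
move: US; rewrite subsetD1 => /andP[_ s0U].
by rewrite cardsU1 s0U addKn.
Qed.

Theorem theorem38 (n r : nat) (hr1 : (1 <= r)%N) (hrn : (r <= n)%N) :
  rho_polar (@generic_mx n r) =
  \sum_(D : {set {set 'I_r}} | partition D [set: 'I_r])
     sign_part (generic_ring n r) D * tr_part (@generic_mx n r) D.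
Proof.
rewrite rho_polarE // squarefree_det_partition; apply: eq_bigr => P _.
by rewrite /sign_part /tr_part big_split /= prodrXr.
Qed.
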